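(* For a generic, transversal, combinatorially stable parameter, functional dimension is attained on any decisive set. That is, let $\theta\in\mathcal{P}_{n_0,\ldots,n_m}$ be a generic, transversal, combinatorially stable parameter, let $Z\subset\mathbb{R}^{n_0}$ be a decisive set for $\theta$, let $k$ be the number of top-dimensional cells of $\mathcal{C}(\theta)$, let $V\subset\mathcal{P}_{n_0,\ldots,n_m}$ be an open neighborhood of $\theta$ that preserves cellular membership of points in $Z$ and such that $Z$ is a decisive set for every $v\in V$, and let $SE_{\theta,Z}:V\to\mathbb{R}^{k(n_0+1)n_m}$ be the simplex evaluation map $SE_{\theta,Z}(v)=E_Z(v)$. Then $$\dim_{\mathrm{fun}}(\theta)=\operatorname{rank} SE_{\theta,Z}|_\theta,$$ where the right-hand side is the rank of the Jacobian matrix of $SE_{\theta,Z}$ at $\theta$.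
   Context: Networks. An architecture is a tuple $(n_0,\ldots,n_m)$ of positive integers with $m\ge 1$. $\sigma$ applies $t\mapsto\max\{0,t\}$ coordinatewise. $\mathcal{P}_{n_0,\ldots,n_m}=\mathbb{R}^{D}$, $D=\sum_{i=1}^m n_i(n_{i-1}+1)$. A parameter $\theta$ is identified with a list of $n_i\times(n_{i-1}+1)$ matrices $[A^i]$, $1\le i\le m$, giving affine maps $A^i(x)=[A^i][x,1]^T$ from $\mathbb{R}^{n_{i-1}}$ to $\mathbb{R}^{n_i}$. Put $F^i=\sigma\circ A^i$ (layer maps) and $\rho(\theta)=F^m\circ\cdots\circ F^1:\mathbb{R}^{n_0}\to\mathbb{R}^{n_m}$. Functional dimension. With $\mathcal{F}(\theta,x)=\rho(\theta)(x)$, a point $x\in\mathbb{R}^{n_0}$ is parametrically smooth for $\theta$ if $\mathcal{F}$ is $C^\infty$ at (i.e. on a neighborhood of) $(\theta,x)$ in $\mathcal{P}_{n_0,\ldots,n_m}\times\mathbb{R}^{n_0}$; a finite set is parametrically smooth for $\theta$ if all its points are; $\theta$ is ordinary if it has at least one parametrically smooth point (generic transversal parameters are ordinary, and points in interiors of top-dimensional cells of $\mathcal{C}(\theta)$ are then parametrically smooth). For finite ordered $Z=\{z_1,\ldots,z_N\}\subset\mathbb{R}^{n_0}$, $E_Z(\theta)=(\rho(\theta)(z_1),\ldots,\rho(\theta)(z_N))\in\mathbb{R}^{Nn_m}$, with Jacobian $\mathbf{J}E_Z|_\theta$ with respect to the parameter. For ordinary $\theta$, $\dim_{\mathrm{fun}}(\theta)=\sup\operatorname{rank}\mathbf{J}E_Z|_\theta$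 over all finite $Z$ parametrically smooth for $\theta$. Canonical polyhedral complex. For the $i$th layer, row $k$ of $[A^i]$ has solution set $S_k=\{x\in\mathbb{R}^{n_{i-1}}:[A^i]_k[x,1]^T=0\}$. Let $R^i$ be the polyhedral decomposition of $\mathbb{R}^{n_{i-1}}$ induced by these sets (cells: nonempty sets cut out by imposing, for each row $k$, one of $\ge0$, $\le0$, $=0$ on $[A^i]_k[x,1]^T$; plus the empty face). Set $\mathcal{C}(F^1)=R^1$ and inductively $\mathcal{C}(F^i\circ\cdots\circ F^1)=\{S\cap(F^{i-1}\circ\cdots\circ F^1)^{-1}(Y): S\in\mathcal{C}(F^{i-1}\circ\cdots\circ F^1),\,Y\in R^i\}$. The canonical polyhedral complex is $\mathcal{C}(\theta)=\mathcal{C}(F^m\circ\cdots\circ F^1)$, a polyhedral decomposition of $\mathbb{R}^{n_0}$; its top-dimensional cells are those of dimension $n_0$. The ternary labeling of $x\in\mathbb{R}^{n_0}$ with respect to $\theta$ is the tuple in $\{-1,0,1\}^{n_1+\cdots+n_m}$ of signs of all coordinates of the pre-activations $(A^\ell\circ F^{\ell-1}\circ\cdots\circ F^1)(x)$, $1\le\ell\le m$; it is constant on the relative interior of each cell of $\mathcal{C}(\theta)$, and so labels cells. Generic. $\theta$ is generic if for every layer $i$ and every set of $p\ge1$ of the solution sets $S_1,\ldots,S_{n_i}\subset\mathbb{R}^{n_{i-1}}$, their intersection is an affine subspace of dimension $n_{i-1}-p$ (empty if this is negative). Transversal. Given a polyhedral complex $\mathcal{C}$ and a function $G:|\mathcal{C}|\to\mathbb{R}$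 affine on cells, $t\in\mathbb{R}$ is a transversal threshold for $G$ and $\mathcal{C}$ if for each $p\in G^{-1}(t)$, $G$ is nonconstant on each cell of $\mathcal{C}$ containing $p$. $\theta$ is transversal if for each $1\le i\le m$, $1\le j\le n_i$, $t=0$ is a transversal threshold for the node map $F_{i,j}=\pi_j\circ A^i\circ F^{i-1}\circ\cdots\circ F^1:\mathbb{R}^{n_0}\to\mathbb{R}$ ($\pi_j$ the $j$th coordinate) and the complex $\mathcal{C}(F^{i-1}\circ\cdots\circ F^1)$ (for $i=1$, the trivial complex with single nonempty cell $\mathbb{R}^{n_0}$). Combinatorially stable. Two polyhedral complexes are combinatorially equivalent via a bijection of cells that is a poset isomorphism for the face relation and preserves dimensions. $\theta$ is combinatorially stable if there are an open neighborhood $U$ of $\theta$ and a continuous map $\Phi:U\times\mathbb{R}^{n_0}\to\mathbb{R}^{n_0}$ such that for every $u\in U$, $\Phi(u,\cdot)$ is a homeomorphism of $\mathbb{R}^{n_0}$ inducing a combinatorial equivalence between $\mathcal{C}(\theta)$ and $\mathcal{C}(u)$ under which corresponding cells have the same ternary labeling on their relative interiors. Decisive sets. $Z\subset\mathbb{R}^{n_0}$ is decisive for $\theta$ if $Z$ consists of, for every top-dimensional cell $C$ of $\mathcal{C}(\theta)$, precisely $n_0+1$ points in the interior of $C$, forming the vertices of an $n_0$-dimensional geometric simplex (so $|Z|=k(n_0+1)$ if there are $k$ top-dimensional cells). A neighborhood $V$ of $\theta$ preserves cellular membership of points in a set $X$ if for every $x\in X$ the set of ternary labelings of all cells of $\mathcal{C}(u)$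 containing $x$ does not depend on $u\in V$. A neighborhood $V$ as in the claim always exists for a generic, transversal, combinatorially stable $\theta$ and decisive $Z$. *)

(* Defs.v *)
From HB Require Import structures.
From mathcomp Require Import all_boot all_order all_algebra.
From mathcomp Require Import all_classical all_reals all_analysis.
Import Order.TTheory GRing.Theory Num.Theory.
Import numFieldNormedType.Exports.

Set Implicit Arguments.
Unset Strict Implicit.
Unset Printing Implicit Defensive.

Local Open Scope classical_set_scope.
Local Open Scope ring_scope.

(* ReLU networks.  Points of R^d are row vectors.  An architecture
   (n_0, ..., n_m) is a function n : nat -> nat of which only the values
   n 0, ..., n m are ever used. *)

Section Smoothness.
Context {R : realType} {V W : normedModType R}.

(* V and W are meant to be finite dimensional, so that the differential is
   C^k as soon as all the directional derivatives are. *)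
Fixpoint Ck_on (k : nat) (U : set V) (f : V -> W) : Prop :=
  match k with
  | 0 => forall x, U x -> {for x, continuous f}
  | k'.+1 => (forall x, U x -> differentiable f x) /\
             (forall v, Ck_on k' U (fun x => 'D_v f x))
  end.

Definition smooth_at (f : V -> W) (x : V) : Prop :=
  exists U : set V, [/\ open U, U x & forall k, Ck_on k U f].

End Smoothness.

Section Homeomorphism.
Context {T U : topologicalType}.

Definition is_homeomorphism (h : T -> U) : Prop :=
  continuous h /\ exists g : U -> T, [/\ continuous g, cancel h g & cancel g h].

End Homeomorphism.

Section AffineGeometry.
Context {R : realType} {d : nat}.
Implicit Types (S F P : set 'rV[R]_d) (C : set (set 'rV[R]_d)).

(* A nonempty affine subspace of dimension e. *)
Definition is_flat (e : nat) S : Prop :=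
  exists (x : 'rV[R]_d) (U : {vspace 'rV[R]_d}),
    \dim U = e /\ S = [set y | y - x \in U].

Definition affine_closed S : Prop :=
  forall (x y : 'rV[R]_d) (t : R), S x -> S y -> S (t *: x + (1 - t) *: y).

Definition affine_hull S : set 'rV[R]_d := smallest affine_closed S.

(* The empty set has no dimension in the sense of this relation. *)
Definition has_dim S (e : nat) : Prop := is_flat e (affine_hull S).

Definition relint S : set 'rV[R]_d :=
  [set x | S x /\ \forall y \near x, affine_hull S y -> S y].

(* a = 0 is allowed: b = 0 gives the face P and b = 1 the empty face. *)
Definition is_face F P : Prop :=
  exists (a : 'rV[R]_d) (b : R),
    (forall x, P x -> (x *m a^T) 0 0 <= b) /\
    F = P `&` [set x | (x *m a^T) 0 0 = b].

Definition affinely_independent (e : nat) (p : 'I_e.+1 -> 'rV[R]_d) : Prop :=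
  free [seq p (lift ord0 i) - p ord0 | i : 'I_e].

Definition transversal_threshold C (G : 'rV[R]_d -> R) (t : R) : Prop :=
  forall p, G p = t -> forall S, C S -> S p ->
    exists x y, [/\ S x, S y & G x != G y].

End AffineGeometry.

Section Layer.
Context {R : realType} {p q : nat}.
Implicit Type A : 'M[R]_(q, p + 1).

(* The transpose of [A][x,1]^T. *)
Definition affine_map A (x : 'rV[R]_p) : 'rV[R]_q :=
  row_mx x (1%:M : 'M[R]_1) *m A^T.

Definition relu (x : 'rV[R]_q) : 'rV[R]_q := map_mx (Num.max 0) x.

Definition layer_map A (x : 'rV[R]_p) : 'rV[R]_q := relu (affine_map A x).

Definition solution_set A (k : 'I_q) : set 'rV[R]_p :=
  [set x | affine_map A x 0 k = 0].

Inductive side := Nonneg | Nonpos | Zero.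

Definition on_side (s : side) (t : R) : Prop :=
  match s with Nonneg => 0 <= t | Nonpos => t <= 0 | Zero => t = 0 end.

Definition arrangement_cell A (s : 'I_q -> side) : set 'rV[R]_p :=
  [set x | forall k, on_side (s k) (affine_map A x 0 k)].

Definition arrangement_complex A : set (set 'rV[R]_p) :=
  set0 |` range (arrangement_cell A).

Definition generic_layer A : Prop :=
  forall J : {set 'I_q}, (0 < #|J|)%N ->
    let S := \bigcap_(k in [set` J]) solution_set A k in
    if (#|J| <= p)%N then is_flat (p - #|J|) S else S = set0.

End Layer.

(* A parameter of depth m.+1 is the concatenation of a parameter of depth m
   and of the coefficients of the matrix of the last layer, so the notions below
   are defined by recursion on the depth. *)

Fixpoint param_dim (n : nat -> nat) (m : nat) : nat :=
  if m is m'.+1 then (param_dim n m' + n m'.+1 * (n m' + 1))%N else 0%N.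

Lemma param_dimE n m :
  param_dim n m = (\sum_(1 <= i < m.+1) n i * (n i.-1 + 1))%N.
Proof.
elim: m => [|m IHm] /=; first by rewrite big_geq.
by rewrite big_nat_recr //= -IHm.
Qed.

Fixpoint node_count (n : nat -> nat) (m : nat) : nat :=
  if m is m'.+1 then (node_count n m' + n m'.+1)%N else 0%N.

Section Network.
Context {R : realType} {n : nat -> nat}.

Definition param (m : nat) := 'rV[R]_(param_dim n m).

Definition init_layers m (theta : param m.+1) : param m :=
  @lsubmx R 1 (param_dim n m) (n m.+1 * (n m + 1)) theta.

Definition last_layer m (theta : param m.+1) : 'M[R]_(n m.+1, n m + 1) :=
  vec_mx (@rsubmx R 1 (param_dim n m) (n m.+1 * (n m + 1)) theta).

Fixpoint realization m : param m -> 'rV[R]_(n 0%N) -> 'rV[R]_(n m) :=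
  match m with
  | 0 => fun _ x => x
  | m'.+1 => fun theta x =>
      layer_map (last_layer theta) (realization (init_layers theta) x)
  end.

Definition preactivation m (theta : param m.+1) (x : 'rV[R]_(n 0%N)) :
    'rV[R]_(n m.+1) :=
  affine_map (last_layer theta) (realization (init_layers theta) x).

(* Depth 0 is the trivial complex of R^(n 0); see canonical_complex1. *)
Fixpoint canonical_complex m : param m -> set (set 'rV[R]_(n 0%N)) :=
  match m with
  | 0 => fun _ => [set setT; set0]
  | m'.+1 => fun theta =>
      [set C | exists S Y,
        [/\ canonical_complex (init_layers theta) S,
            arrangement_complex (last_layer theta) Y &
            C = S `&` realization (init_layers theta) @^-1` Y]]
  end.

Lemma canonical_complex1 (theta : param 1) :
  canonical_complex theta = arrangement_complex (last_layer theta).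
Proof.
apply/seteqP; split=> [C [S [Y [/= hS hY ->]]]|Y hY] /=.
  have -> : (id : 'rV[R]_(n 0%N) -> _) @^-1` Y = Y by [].
  by case: hS => ->; rewrite ?setTI // set0I; left.
by exists setT, Y; split=> //; [left|rewrite setTI].
Qed.

Definition top_cells m (theta : param m) : set (set 'rV[R]_(n 0%N)) :=
  [set C | canonical_complex theta C /\ has_dim C (n 0%N)].

Fixpoint ternary_label m : param m -> 'rV[R]_(n 0%N) -> 'rV[int]_(node_count n m) :=
  match m with
  | 0 => fun _ _ => 0
  | m'.+1 => fun theta x =>
      row_mx (ternary_label (init_layers theta) x)
             (map_mx (@sgz R) (preactivation theta x))
  end.

(* The labels taken on the relative interior: a singleton for a nonempty cell
   of the canonical complex, and empty for the empty cell. *)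
Definition cell_label m (theta : param m) (C : set 'rV[R]_(n 0%N)) :
    set 'rV[int]_(node_count n m) :=
  ternary_label theta @` relint C.

Fixpoint generic_param m : param m -> Prop :=
  match m with
  | 0 => fun _ => True
  | m'.+1 => fun theta =>
      generic_param (init_layers theta) /\ generic_layer (last_layer theta)
  end.

Fixpoint transversal_param m : param m -> Prop :=
  match m with
  | 0 => fun _ => True
  | m'.+1 => fun theta =>
      transversal_param (init_layers theta) /\
      forall j, transversal_threshold (canonical_complex (init_layers theta))
                  (fun x => preactivation theta x 0 j) 0
  end.

Definition induces_comb_equiv m (theta u : param m)
    (h : 'rV[R]_(n 0%N) -> 'rV[R]_(n 0%N)) : Prop :=
  let C := canonical_complex theta in
  [/\ set_bij C (canonical_complex u) (fun S => h @` S),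
      (forall S T, C S -> C T -> is_face S T <-> is_face (h @` S) (h @` T)),
      (forall S e, C S -> has_dim S e <-> has_dim (h @` S) e) &
      (forall S, C S -> cell_label theta S = cell_label u (h @` S))].

Definition comb_stable m (theta : param m) : Prop :=
  exists (U : set (param m)) (Phi : param m * 'rV[R]_(n 0%N) -> 'rV[R]_(n 0%N)),
    [/\ open U, U theta, {within U `*` setT, continuous Phi} &
        forall u, U u -> is_homeomorphism (fun x => Phi (u, x)) /\
                         induces_comb_equiv theta u (fun x => Phi (u, x))].

Definition decisive m (theta : param m) (Z : set 'rV[R]_(n 0%N)) : Prop :=
  Z `<=` \bigcup_(C in top_cells theta) C^° /\
  forall C, top_cells theta C ->
    exists p : 'I_(n 0%N).+1 -> 'rV[R]_(n 0%N),
      affinely_independent p /\ Z `&` C^° = range p.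

Definition preserves_membership m (V : set (param m)) (X : set 'rV[R]_(n 0%N)) :
    Prop :=
  forall x, X x -> forall u v, V u -> V v ->
    \bigcup_(C in [set C | canonical_complex u C /\ C x]) cell_label u C =
    \bigcup_(C in [set C | canonical_complex v C /\ C x]) cell_label v C.

Definition parametrically_smooth m (theta : param m) (x : 'rV[R]_(n 0%N)) : Prop :=
  smooth_at (fun tx : param m * 'rV[R]_(n 0%N) => realization tx.1 tx.2)
            (theta, x).

(* A finite ordered subset of R^(n 0) with N points is an injection from 'I_N. *)
Definition eval_map m N (z : 'I_N -> 'rV[R]_(n 0%N)) (theta : param m) :
    'rV[R]_(N * n m) :=
  mxvec (\matrix_(i < N) realization theta (z i)).

(* Intended for ordinary parameters; for the others, Z empty gives 0. *)
Definition dim_fun m (theta : param m) : \bar R :=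
  ereal_sup [set r | exists N (z : 'I_N -> 'rV[R]_(n 0%N)),
    [/\ injective z, forall i, parametrically_smooth theta (z i) &
        r = (\rank ('J (eval_map z) theta))%:R%:E]].

End Network.

Arguments param R n m : clear implicits.

(* Main.v *)
Require Import Defs.
From HB Require Import structures.
From mathcomp Require Import all_boot all_order all_algebra.
From mathcomp Require Import all_classical all_reals all_analysis.
Import Order.TTheory GRing.Theory Num.Theory.
Import numFieldNormedType.Exports.

Local Open Scope classical_set_scope.
Local Open Scope ring_scope.

(* Fixing the set of active units replaces every ReLU by a coordinate
   projection, so that the network becomes a map which is polynomial in
   (theta, x) and affine in x.  At a point x where no preactivation vanishes the
   realization agrees with such a map near (theta, x).  Transversality gives two
   facts: no preactivation vanishes in the interior of a cell, for otherwise it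
   would be an affine function of constant sign with an interior zero, hence
   constantly zero on the cell; and the points where none vanishes are dense.
   Let v be in the kernel of the Jacobian of E_Z.  On a top-dimensional cell the
   derivative along v of the realization is affine in x and vanishes at n_0 + 1
   affinely independent points, hence everywhere on the interior.  By density
   and continuity it vanishes at every parametrically smooth point, so v is in
   the kernel of the Jacobian of every other evaluation map. *)

(** * Differentials of linear maps and of germs *)

Lemma linear_fun_diff {R : realType} {V W : normedModType R} (f : V -> W) x :
  linear f -> continuous f -> differentiable f x /\ ('d f x = f :> (V -> W)).
Proof.
move=> flin fcont.
pose fL : {linear V -> W} := HB.pack f (GRing.isLinear.Build _ _ _ _ _ flin).
split; first exact: (@linear_differentiable _ _ _ fL).
exact: (@diff_lin _ _ _ fL).
Qed.

(** Differentiability depends only on the germ: the first-order expansion of [f] at [x] is also one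
    of [g], and uniqueness of the differential identifies ['d g x] with ['d f x]. *)
Lemma near_eq_differentiable {R : realType} {V W : normedModType R}
    (f g : V -> W) (x : V) :
  (\forall y \near x, f y = g y) -> differentiable f x -> differentiable g x.
Proof.
move=> fg; have fg0 := fg; move=> /diff_locallyP [dc /eqaddoP df].
have dg : g \o shift x = cst (g x) + 'd f x +o_ 0 id.
  apply/eqaddoP => e e0; have := df e e0.
  move: fg; rewrite (near_shift 0) subr0 => fg.
  apply: filterS2 fg => y /= fgy.
  by rewrite !fctE /= fgy (nbhs_singleton fg0).
apply/diff_locallyP; split.
  by rewrite (diff_unique dc dg).
by rewrite (diff_unique dc dg).
Qed.

(** * Polynomial functions and their smoothness *)

Section PolynomialFunctions.
Context {R : realType} {V : normedModType R}.

(** This class is closed under directional derivatives, so differentiability of its members already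
    yields every [Ck_on]. Continuity is asked of the linear functions because [V] may be infinite
    dimensional. *)
Inductive polynomial_fun : (V -> R) -> Prop :=
| polynomial_cst c : polynomial_fun (cst c)
| polynomial_linear f : linear f -> continuous f -> polynomial_fun f
| polynomialD f g :
    polynomial_fun f -> polynomial_fun g -> polynomial_fun (f + g)
| polynomialM f g :
    polynomial_fun f -> polynomial_fun g -> polynomial_fun (f * g).

Lemma polynomial_sum {I : Type} (r : seq I) (P : pred I) (f : I -> V -> R) :
  (forall i, polynomial_fun (f i)) ->
  polynomial_fun (fun x => \sum_(i <- r | P i) f i x).
Proof.
move=> pf; rewrite -fct_sumE.
by elim/big_ind: _ => //; [exact: polynomial_cst|exact: polynomialD].
Qed.

Lemma polynomial_differentiable f x : polynomial_fun f -> differentiable f x.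
Proof.
elim=> {f} [c|f flin fcont|f g _ df _ dg|f g _ df _ dg].
- exact: differentiable_cst.
- by have [] := linear_fun_diff f x flin fcont.
- exact: differentiableD.
- exact: differentiableM.
Qed.

Lemma polynomial_continuous f : polynomial_fun f -> continuous f.
Proof.
by move=> pf x; exact/differentiable_continuous/polynomial_differentiable.
Qed.

Lemma polynomial_derive f v : polynomial_fun f -> polynomial_fun ('D_v f).
Proof.
have dP h x : polynomial_fun h -> derivable h x v.
  by move=> ph; exact/diff_derivable/polynomial_differentiable.
elim=> {f} [c|f flin fcont|f g pf df pg dg|f g pf df pg dg].
- rewrite (_ : 'D_v _ = cst 0); first exact: polynomial_cst.
  by apply/funext => x; rewrite derive_cst.
- rewrite (_ : 'D_v _ = cst (f v)); first exact: polynomial_cst.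
  apply/funext => x; have [df dfE] := linear_fun_diff f x flin fcont.
  by rewrite deriveE// dfE.
- rewrite (_ : 'D_v _ = 'D_v f + 'D_v g); first exact: polynomialD.
  by apply/funext => x; rewrite deriveD//; exact: dP.
- rewrite (_ : 'D_v _ = f * 'D_v g + g * 'D_v f); last first.
    by apply/funext => x; rewrite deriveM//; exact: dP.
  by apply: polynomialD; apply: polynomialM.
Qed.

Definition polynomial_map {d} (f : V -> 'rV[R]_d) : Prop :=
  forall j, polynomial_fun (fun x => f x 0 j).

Lemma row_map_decomp {d} (f : V -> 'rV[R]_d) :
  f = \sum_(j < d) (fun x => f x 0 j *: delta_mx 0 j).
Proof. by apply/funext => x; rewrite {1}[f x]row_sum_delta fct_sumE. Qed.

Lemma differentiable_coordinates {d} (f : V -> 'rV[R]_d) x :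
  (forall j, differentiable (fun x => f x 0 j) x) -> differentiable f x.
Proof.
move=> df; rewrite (row_map_decomp f); apply: differentiable_sum => j.
exact: differentiableZl.
Qed.

Lemma polynomial_map_differentiable {d} (f : V -> 'rV[R]_d) x :
  polynomial_map f -> differentiable f x.
Proof.
move=> pf; apply: differentiable_coordinates => j.
exact: polynomial_differentiable.
Qed.

Lemma polynomial_pair_continuous {d e} (f : V -> 'rV[R]_d) (g : V -> 'rV[R]_e) :
  polynomial_map f -> polynomial_map g -> continuous (fun x => (f x, g x)).
Proof.
move=> pf pg x; apply: differentiable_continuous.
by apply: differentiable_pair; exact: polynomial_map_differentiable.
Qed.

Lemma polynomial_map_cst {d} (c : 'rV[R]_d) : polynomial_map (cst c).
Proof. by move=> j; exact: polynomial_cst. Qed.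

Lemma polynomial_map_derive {d} (f : V -> 'rV[R]_d) v :
  polynomial_map f -> polynomial_map ('D_v f).
Proof.
move=> pf j; rewrite (_ : (fun _ => _) = 'D_v (fun x => f x 0 j)).
  exact: polynomial_derive.
apply/funext => x; rewrite derive_mx ?mxE//.
exact/diff_derivable/polynomial_map_differentiable.
Qed.

Lemma polynomial_map_Ck {d} (f : V -> 'rV[R]_d) k (U : set V) :
  polynomial_map f -> Ck_on k U f.
Proof.
elim: k f => [|k IH] f pf /=.
  move=> x _; exact/differentiable_continuous/polynomial_map_differentiable.
split=> [x _|v]; first exact: polynomial_map_differentiable.
exact/IH/polynomial_map_derive.
Qed.

End PolynomialFunctions.

Section Coordinates.
Context {R : realType}.

Lemma polynomial_id {d} : polynomial_map (id : 'rV[R]_d -> 'rV[R]_d).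
Proof.
move=> j; apply: polynomial_linear; first by move=> a u v; rewrite !mxE.
exact: coord_continuous.
Qed.

Lemma polynomial_fst {d} {V : normedModType R} :
  polynomial_map (fst : 'rV[R]_d * V -> 'rV[R]_d).
Proof.
move=> j; apply: polynomial_linear; first by move=> a u v; rewrite !mxE.
move=> p; apply: (@cvg_comp _ _ _ fst (fun x : 'rV[R]_d => x 0 j)).
  exact: cvg_fst.
exact: coord_continuous.
Qed.

Lemma polynomial_snd {d} {V : normedModType R} :
  polynomial_map (snd : V * 'rV[R]_d -> 'rV[R]_d).
Proof.
move=> j; apply: polynomial_linear; first by move=> a u v; rewrite !mxE.
move=> p; apply: (@cvg_comp _ _ _ snd (fun x : 'rV[R]_d => x 0 j)).
  exact: cvg_snd.
exact: coord_continuous.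
Qed.

End Coordinates.

(** Since [U] is open, [f] and [g] agree near each of its points, so their directional derivatives
    agree on [U] as well and the induction applies to these. *)
Lemma eq_on_Ck {R : realType} {V W : normedModType R} k (U : set V)
    (f g : V -> W) :
  open U -> (forall x, U x -> f x = g x) -> Ck_on k U f -> Ck_on k U g.
Proof.
move=> oU; elim: k f g => [|k IH] f g fg /=.
  move=> cf x Ux; have nfg : \forall y \near x, f y = g y.
    by apply: filterS (open_nbhs_nbhs (conj oU Ux)) => y /fg.
  rewrite /prop_for /continuous_at -(fg x Ux); apply: cvg_trans (cf x Ux).
  exact: near_eq_cvg.
move=> [df cf]; split=> [x Ux|v].
  apply: near_eq_differentiable (df x Ux).
  by apply: filterS (open_nbhs_nbhs (conj oU Ux)) => y /fg.
apply: IH (cf v) => x Ux; apply: near_eq_derive.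
by apply: filterS (open_nbhs_nbhs (conj oU Ux)) => y /fg.
Qed.

Lemma near_polynomial_smooth {R : realType} {V : normedModType R} {d}
    (f g : V -> 'rV[R]_d) (x : V) :
  polynomial_map f -> (\forall y \near x, f y = g y) -> smooth_at g x.
Proof.
move=> pf; rewrite /prop_near1 nbhsE => -[U [oU Ux] fg].
exists U; split=> // k; apply: (@eq_on_Ck _ _ _ k U f g) => //.
exact: polynomial_map_Ck.
Qed.

(** * Affine functions and affine bases *)

Section AffineFunctions.
Context {R : realType} {d : nat} {V : lmodType R}.

(** Phrased with any number of points, affinity passes to compositions without naming a linear part
    and applies at once to all vertices of a simplex. *)
Definition preserves_affine_combinations (f : 'rV[R]_d -> V) : Prop :=
  forall N (c : 'I_N -> R) (x : 'I_N -> 'rV[R]_d), \sum_i c i = 1 ->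
    f (\sum_i c i *: x i) = \sum_i c i *: f (x i).

Lemma preserves_affine_line f (x y : 'rV[R]_d) (t : R) :
  preserves_affine_combinations f ->
  f (x + t *: (y - x)) = (1 - t) *: f x + t *: f y.
Proof.
move=> /(_ 2%N (fun i => if i == ord0 then 1 - t else t)
               (fun i => if i == ord0 then x else y)).
rewrite !big_ord_recl !big_ord0 /= !addr0 subrK => <-//.
by rewrite scalerBr scalerBl scale1r addrA addrAC.
Qed.

End AffineFunctions.

(** On the line [x + t *: (y - x)] the value of [G] is [t * G y]. Nonnegativity for small [t] of
    both signs forces [G y = 0]. *)
Lemma affine_ge0_near_zero {R : realType} {d}
    (G : 'rV[R]_d -> R) (x : 'rV[R]_d) :
  preserves_affine_combinations (G : 'rV[R]_d -> R^o) ->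
  G x = 0 -> (\forall y \near x, 0 <= G y) -> forall y, G y = 0.
Proof.
move=> affG Gx0 Gge0 y.
have cl : (fun t : R => x + t *: (y - x)) t @[t --> 0] --> x.
  rewrite -[X in _ --> X]addr0 -[X in x + X](scale0r (y - x)).
  by apply: cvgD; [exact: cvg_cst|exact: cvgZr_tmp].
have : \forall t \near (0 : R), 0 <= t * G y.
  near=> t; have : 0 <= G (x + t *: (y - x)).
    by near: t; exact: cl Gge0.
  by rewrite (preserves_affine_line _ _ _ _ affG) Gx0 scaler0 add0r.
move=> /nbhs_ballP[e /= e0 be].
have e20 : 0 < e / 2 by rewrite divr_gt0.
have e2e : e / 2 < e by rewrite ltr_pdivrMr// mulrC mulrDl mul1r ltrDl.
apply/eqP; rewrite eq_le; apply/andP; split.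
- have := be (- (e / 2)); rewrite /ball /= sub0r opprK gtr0_norm// => /(_ e2e).
  by rewrite mulNr oppr_ge0 pmulr_rle0.
- have := be (e / 2); rewrite /ball /= sub0r normrN gtr0_norm// => /(_ e2e).
  by rewrite pmulr_rge0.
Unshelve. all: by end_near. Qed.

(** The [d] free differences form a basis of the space. The coordinates of [y - p ord0] are the
    weights of the other vertices, and [p ord0] receives what is missing to reach 1. *)
Lemma affine_span {R : realType} {d} (p : 'I_d.+1 -> 'rV[R]_d) y :
  affinely_independent p ->
  exists c : 'I_d.+1 -> R, \sum_i c i = 1 /\ y = \sum_i c i *: p i.
Proof.
rewrite /affinely_independent => fp.
set X := [seq _ | _ : 'I_d] in fp.
have sX : size X == d by rewrite size_map size_enum_ord.
have bX : basis_of fullv (Tuple sX).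
  by rewrite basisEfree fp subvf /= dimvf /dim /= mul1n (eqP sX).
pose a i := coord (Tuple sX) i (y - p ord0).
have yE := coord_basis bX (memvf (y - p ord0)).
have {}yE : y - p ord0 = \sum_i a i *: (p (lift ord0 i) - p ord0).
  rewrite [LHS]yE; apply: eq_bigr => i _; congr (_ *: _).
  by rewrite (nth_map i) ?size_enum_ord// nth_ord_enum.
pose c i := if unlift ord0 i is Some j then a j else 1 - \sum_j a j.
have cS (i : 'I_d) : c (lift ord0 i) = a i by rewrite /c liftK.
have c0 : c ord0 = 1 - \sum_j a j by rewrite /c unlift_none.
exists c; split; rewrite big_ord_recl c0.
  by rewrite (eq_bigr _ (fun i _ => cS i)) subrK.
rewrite (eq_bigr (fun i => a i *: p (lift ord0 i))) => [|i _]; last first.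
  by rewrite cS.
move/eqP: yE; rewrite subr_eq => /eqP ->.
rewrite (eq_bigr _ (fun i _ => scalerBr (a i) _ _)) sumrB -scaler_suml.
by rewrite scalerBl scale1r [RHS]addrC -addrA [- _ + _]addrC.
Qed.

(** * Networks with a fixed activation pattern *)

Section ActivationPatterns.
Context {R : realType} {n : nat -> nat}.

(* In an activation pattern s, [s i j] tells whether unit j of layer i.+1 is
   active. *)
Definition mask {q} (b : nat -> bool) (y : 'rV[R]_q) : 'rV[R]_q :=
  \row_j if b j then y 0 j else 0.

Fixpoint masked_realization (s : nat -> nat -> bool) m :
    param R n m -> 'rV[R]_(n 0%N) -> 'rV[R]_(n m) :=
  match m with
  | 0 => fun _ x => x
  | m'.+1 => fun theta x =>
      mask (s m') (affine_map (last_layer theta)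
                     (masked_realization s m' (init_layers theta) x))
  end.

Definition masked_preactivation s m (theta : param R n m.+1)
    (x : 'rV[R]_(n 0%N)) : 'rV[R]_(n m.+1) :=
  affine_map (last_layer theta)
    (masked_realization s m (init_layers theta) x).

(* The relation r is <%R for the open region of the pattern s, and <=%R for the
   closed one. *)
Fixpoint in_pattern (r : rel R) (s : nat -> nat -> bool) m :
    param R n m -> 'rV[R]_(n 0%N) -> Prop :=
  match m with
  | 0 => fun _ _ => True
  | m'.+1 => fun theta x =>
      in_pattern r s m' (init_layers theta) x /\
      forall j : 'I_(n m'.+1),
        let t := preactivation theta x 0 j in if s m' j then r 0 t else r t 0
  end.

Lemma in_patternW s m (theta : param R n m) x :
  in_pattern <%R s m theta x -> in_pattern <=%R s m theta x.
Proof.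
elim: m theta => //= m IH theta [/IH ? h]; split=> // j.
by have := h j; case: ifP => _ /ltW.
Qed.

(** The closed region suffices: at a zero preactivation, keeping the coordinate and erasing it both
    give the ReLU value 0. *)
Lemma realization_masked s m (theta : param R n m) x :
  in_pattern <=%R s m theta x ->
  realization theta x = masked_realization s m theta x.
Proof.
elim: m theta => //= m IH theta [/IH ih h].
apply/rowP => j; rewrite /layer_map /relu mxE [RHS]mxE -ih; have /= := h j.
rewrite /preactivation; case: ifP => _ hj; first exact: max_r.
exact: max_l.
Qed.

Lemma preactivation_masked s m (theta : param R n m.+1) x :
  in_pattern <=%R s m (init_layers theta) x ->
  preactivation theta x = masked_preactivation s m theta x.
Proof. by move=> h; rewrite /preactivation (realization_masked _ _ _ _ h). Qed.

Lemma affine_mapE {p q} (A : 'M[R]_(q, p + 1)) x j :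
  affine_map A x 0 j =
  \sum_i x 0 i * A j (lshift 1 i) + A j (rshift p ord0).
Proof.
rewrite /affine_map mxE big_split_ord /= big_ord1.
congr (_ + _); last by rewrite row_mxEr !mxE mul1r.
by apply: eq_bigr => i _; rewrite row_mxEl mxE.
Qed.

(** Weights of sum 1 keep the last coordinate of the extended vector (x, 1) equal to 1; the matrix
    then acts linearly. *)
Lemma affine_map_combination {p q} (A : 'M[R]_(q, p + 1)) :
  preserves_affine_combinations (affine_map A).
Proof.
move=> N c x c1; rewrite /affine_map.
rewrite (_ : row_mx _ _ = \sum_i c i *: row_mx (x i) 1%:M).
  by rewrite mulmx_suml; apply: eq_bigr => i _; rewrite scalemxAl.
apply/rowP => j; rewrite summxE.
case: (splitP j) => k jk.
  rewrite (_ : j = lshift 1 k); last exact: val_inj.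
  rewrite row_mxEl summxE; apply: eq_bigr => i _.
  by rewrite mxE [in RHS]mxE row_mxEl.
rewrite (_ : j = rshift p k); last exact: val_inj.
rewrite row_mxEr mxE (ord1 k) eqxx mulr1n -[LHS]c1; apply: eq_bigr => i _.
by rewrite mxE row_mxEr mxE eqxx mulr1.
Qed.

Lemma masked_realization_affine s m (theta : param R n m) :
  preserves_affine_combinations (masked_realization s m theta).
Proof.
elim: m theta => [|m IH] theta N c x c1 //=.
rewrite IH// affine_map_combination//.
apply/rowP => j; rewrite !mxE !summxE; case: ifP => sj.
  by apply: eq_bigr => i _; rewrite !mxE sj.
by rewrite big1// => i _; rewrite !mxE sj mulr0.
Qed.

Lemma masked_preactivation_affine s m (theta : param R n m.+1) j :
  preserves_affine_combinations
    (fun x => masked_preactivation s m theta x 0 j : R^o).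
Proof.
move=> N c x c1; rewrite /masked_preactivation masked_realization_affine//.
rewrite affine_map_combination// summxE.
by apply: eq_bigr => i _; rewrite mxE.
Qed.

(** * Polynomial dependence on the parameter and the point *)

Lemma last_layerE m (theta : param R n m.+1) i j :
  last_layer theta i j = theta 0 (rshift (param_dim n m) (mxvec_index i j)).
Proof. by rewrite /last_layer !mxE. Qed.

Lemma polynomial_affine_map {V : normedModType R} {m} (G : V -> param R n m.+1)
    (h : V -> 'rV[R]_(n m)) :
  polynomial_map G -> polynomial_map h ->
  polynomial_map (fun p => affine_map (last_layer (G p)) (h p)).
Proof.
move=> pG ph j.
rewrite (_ : (fun _ => _) =
    (fun p => \sum_i ((fun p => h p 0 i) *
                      (fun p => last_layer (G p) j (lshift 1 i))) p) +
    (fun p => last_layer (G p) j (rshift (n m) ord0))); last first.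
  by apply/funext => p; rewrite affine_mapE.
have pL i : polynomial_fun (fun p => last_layer (G p) j i).
  rewrite (_ : (fun _ => _) =
    (fun p => G p 0 (rshift (param_dim n m) (mxvec_index j i)))).
    exact: pG.
  by apply/funext => p; rewrite last_layerE.
apply: polynomialD => //; apply: polynomial_sum => i; apply: polynomialM => //.
Qed.

Lemma polynomial_init {V : normedModType R} {m} (G : V -> param R n m.+1) :
  polynomial_map G -> polynomial_map (fun p => init_layers (G p)).
Proof.
move=> pG j; rewrite (_ : (fun _ => _) = fun p => G p 0 (lshift _ j)).
  exact: pG.
by apply/funext => p; rewrite mxE.
Qed.

(** The space [V] and the maps [g], [G] are left free so that one statement covers the dependence on
    the pair and on either variable alone, the other map being constant. *)
Lemma polynomial_masked_realization {V : normedModType R} s m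
    (g : V -> 'rV[R]_(n 0%N)) (G : V -> param R n m) :
  polynomial_map g -> polynomial_map G ->
  polynomial_map (fun p => masked_realization s m (G p) (g p)).
Proof.
move=> pg; elim: m G => [//|m IH] G pG j /=.
case E : (s m j); last first.
  rewrite (_ : (fun _ => _) = cst 0); first exact: polynomial_cst.
  by apply/funext => p; rewrite mxE E.
rewrite (_ : (fun _ => _) = fun p => affine_map (last_layer (G p))
    (masked_realization s m (init_layers (G p)) (g p)) 0 j); last first.
  by apply/funext => p; rewrite mxE E.
apply: polynomial_affine_map => //.
exact/IH/polynomial_init.
Qed.

Lemma polynomial_masked_preactivation {V : normedModType R} s m
    (g : V -> 'rV[R]_(n 0%N)) (G : V -> param R n m.+1) :
  polynomial_map g -> polynomial_map G ->
  polynomial_map (fun p => masked_preactivation s m (G p) (g p)).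
Proof.
move=> pg pG; apply: polynomial_affine_map => //.
by apply: polynomial_masked_realization => //; exact: polynomial_init.
Qed.

(** * Extension and openness of pattern regions *)

Lemma eq_in_pattern r s s' m (theta : param R n m) x :
  (forall i, (i < m)%N -> s i = s' i) ->
  in_pattern r s m theta x -> in_pattern r s' m theta x.
Proof.
elim: m theta => //= m IH theta ss' [h hj]; split.
  by apply: IH h => i im; apply: ss'; exact: ltnW.
by move=> j; have := hj j; rewrite ss'.
Qed.

(** Index [m] stands for layer [m.+1]. Patterns take natural numbers, hence [insub]; its default
    [false] concerns only indices beyond the units of the layer. *)
Definition extend_pattern (s : nat -> nat -> bool) m {q} (f : 'I_q -> bool) :
    nat -> nat -> bool :=
  fun i => if i == m then fun j => oapp f false (insub j) else s i.

Lemma in_extend_pattern r s m (f : 'I_(n m.+1) -> bool)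
    (theta : param R n m.+1) x :
  in_pattern r s m (init_layers theta) x ->
  (forall j, let t := preactivation theta x 0 j in
             if f j then r 0 t else r t 0) ->
  in_pattern r (extend_pattern s m f) m.+1 theta x.
Proof.
move=> h hf; split.
  by apply: eq_in_pattern h => i im; rewrite /extend_pattern ltn_eqF.
by move=> j; have := hf j; rewrite /extend_pattern eqxx valK.
Qed.

(** Where the earlier layers keep their pattern, the preactivation is the masked one, hence
    continuous, and the finitely many strict inequalities of the last layer persist. *)
Lemma in_pattern_near s m (theta : param R n m) x :
  in_pattern <%R s m theta x ->
  \forall p \near (theta, x), in_pattern <%R s m p.1 p.2.
Proof.
elim: m theta => [|m IH] theta /=; first by move=> _; exact: filterT.
move=> [h hj].
have cinit := polynomial_pair_continuous
  (fun p : param R n m.+1 * 'rV[R]_(n 0%N) => init_layers p.1) snd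
  (polynomial_init fst polynomial_fst) polynomial_snd (theta, x).
have hinit : \forall p \near (theta, x),
    in_pattern <%R s m (init_layers p.1) p.2 by exact: (cinit _ (IH _ h)).
have hpre (j : 'I_(n m.+1)) : \forall p \near (theta, x),
    let t := masked_preactivation s m p.1 p.2 0 j in
    if s m j then 0 < t else t < 0.
  have := hj j.
  rewrite (preactivation_masked s); last exact: in_patternW.
  have cj := polynomial_continuous _ (polynomial_masked_preactivation s m
    snd fst polynomial_snd polynomial_fst j) (theta, x).
  by case: ifP => _ hs; [exact: (cvgr_gt _ cj)|exact: (cvgr_lt _ cj)].
apply: filterS2 hinit (filter_forall _ hpre) => p hp hpj; split=> // j.
by rewrite (preactivation_masked s); [exact: hpj|exact: in_patternW].
Qed.

Lemma in_pattern_near_point s m (theta : param R n m) x :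
  in_pattern <%R s m theta x -> \forall y \near x, in_pattern <%R s m theta y.
Proof.
move=> /in_pattern_near; apply: (polynomial_pair_continuous (cst theta) id).
  exact: polynomial_map_cst.
exact: polynomial_id.
Qed.

Lemma in_pattern_near_param s m (theta : param R n m) x :
  in_pattern <%R s m theta x -> \forall u \near theta, in_pattern <%R s m u x.
Proof.
move=> /in_pattern_near; apply: (polynomial_pair_continuous id (cst x)).
  exact: polynomial_id.
exact: polynomial_map_cst.
Qed.

Lemma in_pattern_smooth s m (theta : param R n m) x :
  in_pattern <%R s m theta x -> parametrically_smooth theta x.
Proof.
move=> h; apply: (near_polynomial_smooth
  (fun p => masked_realization s m p.1 p.2)).
  exact: polynomial_masked_realization polynomial_snd polynomial_fst.
apply: filterS (in_pattern_near _ _ _ _ h) => p /in_patternW hp.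
by rewrite (realization_masked s).
Qed.

(** * Cells under transversality *)

Lemma pattern_cell s m (theta : param R n m) :
  canonical_complex theta [set x | in_pattern <=%R s m theta x].
Proof.
elim: m theta => [|m IH] theta /=.
  by left; apply/seteqP; split.
exists [set x | in_pattern <=%R s m (init_layers theta) x].
exists (arrangement_cell (last_layer theta)
  (fun j => if s m j then Nonneg else Nonpos)); split.
- exact: IH.
- by right; exists (fun j : 'I_(n m.+1) => if s m j then Nonneg else Nonpos).
- apply/seteqP; split=> x /= [h hj]; split=> // j.
  + by have := hj j; rewrite /preactivation; case: ifP.
  + by have := hj j; rewrite /preactivation; case: ifP.
Qed.

(** If the preactivation vanishes at [x], transversality gives two points of [S] with different
    values, one of them nonzero; otherwise [x] itself will do. *)
Lemma transversal_preactivation_neq0 s m (theta : param R n m.+1) S x j :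
  transversal_param theta -> canonical_complex (init_layers theta) S -> S x ->
  S `<=` [set y | in_pattern <=%R s m (init_layers theta) y] ->
  exists y, masked_preactivation s m theta y 0 j != 0.
Proof.
move=> [_ trans] cS Sx Ss.
have [x0|x0] := eqVneq (preactivation theta x 0 j) 0; last first.
  by exists x; rewrite -preactivation_masked//; exact: Ss.
have [y [z [/Ss Sy /Ss Sz]]] := trans j x x0 S cS Sx.
rewrite !(preactivation_masked s)//.
have [->|y0 _] := eqVneq (masked_preactivation s m theta y 0 j) 0.
  by rewrite eq_sym => z0; exists z.
by exists y.
Qed.

(** One pattern serves the whole cell; [x] witnesses that the interior, and hence each arrangement
    cell involved, is nonempty. *)
Lemma cell_interior_pattern m (theta : param R n m) C x :
  transversal_param theta -> canonical_complex theta C -> C^° x ->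
  exists s, C `<=` [set y | in_pattern <=%R s m theta y] /\
            C^° `<=` [set y | in_pattern <%R s m theta y].
Proof.
elim: m theta C x => [|m IH] theta C x.
  by move=> _ _ _; exists (fun _ _ => true); split.
move=> trans [S [Y [cS cY CE]]] Cx.
have [trans' _] := trans.
have CS : C `<=` S by rewrite CE => y [].
have [s [Sle Slt]] := IH _ _ x trans' cS (interiorS CS Cx).
case: cY => [Y0|[sd _ YE]].
  have /interior_subset := Cx; rewrite CE Y0 => -[_ []].
have Csd y j : C y -> on_side (sd j) (preactivation theta y 0 j).
  by rewrite CE -YE => -[_]; exact.
(* A [Zero] side is recorded as inactive, which the closed region allows. *)
pose f j := if sd j is Nonneg then true else false.
exists (extend_pattern s m f); split=> y Cy.
  apply: in_extend_pattern; first exact/Sle/CS.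
  move=> j /=; have := Csd y j Cy; rewrite /f.
  by case: (sd j) => //= ->.
apply: in_extend_pattern; first exact/Slt/(interiorS CS).
move=> j /=; have := Csd y j (interior_subset Cy).
have Gy z : C z -> preactivation theta z = masked_preactivation s m theta z.
  by move=> Cz; rewrite (preactivation_masked s)//; exact/Sle/CS.
suff : preactivation theta y 0 j != 0.
  by rewrite /f lt_neqAle [_ < 0]lt_neqAle eq_sym => ->; case: (sd j) => //= ->.
apply/eqP => y0.
have Sy := CS _ (interior_subset Cy).
have [z /eqP] := transversal_preactivation_neq0 s m theta S y j trans cS Sy Sle.
have affG := masked_preactivation_affine s m theta j.
rewrite Gy in y0; last exact: interior_subset.
(* Up to sign the function is nonnegative near [y]; a [Zero] side falls under the first case. *)
have side0 : (\forall w \near y, 0 <= masked_preactivation s m theta w 0 j) \/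
             (\forall w \near y, 0 <= - masked_preactivation s m theta w 0 j).
  have nC : \forall w \near y,
      on_side (sd j) (masked_preactivation s m theta w 0 j).
    by apply: filterS Cy => w Cw; rewrite -Gy//; exact: Csd.
  case: (sd j) nC => /= nC; [left|right|left] => //.
  - by apply: filterS nC => w; rewrite oppr_ge0.
  - by apply: filterS nC => w ->.
apply; case: side0 => hG.
  exact: (affine_ge0_near_zero _ _ affG y0 hG).
have affN : preserves_affine_combinations
    ((fun x => - masked_preactivation s m theta x 0 j) : _ -> R^o).
  move=> N c p c1; rewrite affG// -sumrN.
  by apply: eq_bigr => i _; rewrite scalerN.
apply: oppr_inj; rewrite oppr0.
apply: (affine_ge0_near_zero _ _ affN _ hG).
by rewrite y0 oppr0.
Qed.

(** Near a point regular for the earlier layers, the last preactivations are affine functions, none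
    identically zero. Their zero sets have empty interior and are avoided one unit at a time by
    small moves. *)
Lemma regular_points_dense m (theta : param R n m) :
  transversal_param theta ->
  dense [set y | exists s, in_pattern <%R s m theta y].
Proof.
elim: m theta => [|m IH] theta.
  by move=> _ O [y Oy] _; exists y; split=> //; exists (fun _ _ => true).
move=> trans O O0 oO; have [trans' _] := trans.
have [y [Oy [s hy]]] := IH _ trans' O O0 oO.
pose G y j := masked_preactivation s m theta y 0 j.
pose P y := O y /\ in_pattern <%R s m (init_layers theta) y.
have Py : \forall y' \near y, P y'.
  apply: filterI; first exact: (open_nbhs_nbhs (conj oO Oy)).
  exact: in_pattern_near_point.
have cG j : continuous (G ^~ j).
  apply: polynomial_continuous.
  by apply: (polynomial_masked_preactivation _ _ id (cst theta));
    [exact: polynomial_id|exact: polynomial_map_cst].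
have G0 j : exists y, G y j != 0.
  apply: (transversal_preactivation_neq0 s m theta
    [set y | in_pattern <=%R s m (init_layers theta) y] y) => //.
  - exact: pattern_cell.
  - exact: in_patternW.
(* Induction on the number of units already made nonzero; [P] is kept on a neighborhood so that a
   further move remains possible. *)
have avoid k : exists y', (\forall z \near y', P z) /\
    forall j : 'I_(n m.+1), (j < k)%N -> G y' j != 0.
  elim: k => [|k [y' [Py' hy']]]; first by exists y.
  have [kn|nk] := ltnP k (n m.+1); last first.
    exists y'; split=> // j _; apply: hy'.
    exact: leq_trans (ltn_ord j) nk.
  pose jk := Ordinal kn.
  suff [z [Pz hz Gz]] : exists z, [/\ \forall z' \near z, P z',
      forall j : 'I_(n m.+1), (j < k)%N -> G z j != 0 & G z jk != 0].
    exists z; split=> // j; rewrite ltnS leq_eqVlt => /orP[/eqP jkE|];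
      last exact: hz.
    by rewrite (_ : j = jk)//; exact: val_inj.
  have [y'0|y'0] := eqVneq (G y' jk) 0; last by exists y'.
  (* Were there no such point, unit [jk] would vanish near [y'], hence everywhere by affinity,
     against [G0]. *)
  apply: contrapT => nz.
  have nQ (j : 'I_(n m.+1)) : \forall z \near y', (j < k)%N -> G z j != 0.
    have [jk'|_] := ltnP j k; last exact: filterE.
    by apply: filterS (cvgr_neq0 _ (cG j y') (hy' j jk')) => z.
  have [z /eqP] := G0 jk; apply.
  apply: (affine_ge0_near_zero _ y'
    (masked_preactivation_affine s m theta jk)) => //.
  have := near_join Py'.
  apply: filterS2 (filter_forall _ nQ) => z' hz' Pz'.
  have [Gz'|Gz'] := eqVneq (G z' jk) 0; first by rewrite [leRHS]Gz'.
  by exfalso; apply: nz; exists z'.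
have [y' [/nbhs_singleton[Oy' sy'] hy']] := avoid (n m.+1).
exists y'; split=> //.
exists (extend_pattern s m (fun j => 0 < preactivation theta y' 0 j)).
apply: in_extend_pattern => // j /=; case: ifP => // /negbT.
rewrite -leNgt le_eqVlt (preactivation_masked s); last exact: in_patternW.
by rewrite (negbTE (hy' j (ltn_ord j))).
Qed.

(** The weights expressing [y] in the vertices do not depend on the parameter, so differentiation in
    the parameter commutes with the affine combination. *)
Lemma derive_masked_realization_eq0 s m (theta v : param R n m)
    (p : 'I_(n 0%N).+1 -> 'rV[R]_(n 0%N)) y :
  affinely_independent p ->
  (forall i, 'D_v (fun u => masked_realization s m u (p i)) theta = 0) ->
  'D_v (fun u => masked_realization s m u y) theta = 0.
Proof.
move=> pind dp; have [c [c1 ->]] := affine_span p y pind.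
have dm i : derivable (fun u => masked_realization s m u (p i)) theta v.
  apply/diff_derivable/polynomial_map_differentiable.
  by apply: (polynomial_masked_realization _ _ (cst (p i)) id);
    [exact: polynomial_map_cst|exact: polynomial_id].
rewrite (_ : (fun _ => _) =
    \sum_i (c i \*: (fun u => masked_realization s m u (p i)))); last first.
  by apply/funext => u; rewrite masked_realization_affine// fct_sumE.
rewrite derive_sum => [|i]; last exact: derivableZ.
by rewrite big1// => i _; rewrite deriveZ// dp scaler0.
Qed.

End ActivationPatterns.

(** * Ranks, interiors and partial derivatives *)

Lemma rank_le_kernel {R : fieldType} {d p q : nat} (A : 'M[R]_(d, p))
    (B : 'M[R]_(d, q)) :
  (forall v : 'rV_d, v *m B = 0 -> v *m A = 0) -> (\rank A <= \rank B)%N.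
Proof.
move=> BA; have : (kermx B <= kermx A)%MS.
  apply/row_subP => i; apply/sub_kermxP/BA.
  by apply/sub_kermxP; exact: row_sub.
move/mxrankS; rewrite !mxrank_ker => h.
(* Each kernel has rank [d] minus the rank of its matrix; undoing this truncated subtraction uses
   that ranks are at most [d]. *)
by rewrite -(subKn (rank_leq_row A)) -(subKn (rank_leq_row B)) leq_sub2l.
Qed.

(** The line from [y] towards any [w] meets [C] in a second point close to [y], and [w] is an affine
    combination of the two. *)
Lemma has_dim_interior {R : realType} {d : nat} (C : set 'rV[R]_d) y :
  C^° y -> has_dim C d.
Proof.
move=> Cy; suff hullT : affine_hull C = setT.
  rewrite /has_dim hullT; exists 0, fullv; split.
    by rewrite dimvf /dim /= mul1n.
  by apply/seteqP; split=> // w _ /=; exact: memvf.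
apply/seteqP; split=> // w _ S [affS CS].
have cl : (fun t : R => y + t *: (w - y)) t @[t --> 0] --> y.
  rewrite -[X in _ --> X]addr0 -[X in y + X](scale0r (w - y)).
  by apply: cvgD; [exact: cvg_cst|exact: cvgZr_tmp].
have : \forall t \near (0 : R), C (y + t *: (w - y)) by exact: cl Cy.
move=> /nbhs_ballP[e /= e0 be].
have e20 : e / 2 != 0 by rewrite gt_eqF// divr_gt0.
have Cz : C (y + (e / 2) *: (w - y)).
  apply: be; rewrite /ball /= sub0r normrN gtr0_norm ?divr_gt0//.
  by rewrite ltr_pdivrMr// mulrC mulrDl mul1r ltrDl.
have -> : w = (e / 2)^-1 *: (y + (e / 2) *: (w - y)) + (1 - (e / 2)^-1) *: y.
  rewrite scalerDr scalerA mulVf// scale1r scalerBl scale1r.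
  by rewrite addrC addrA subrK addrC subrK.
by apply: affS; apply: CS => //; exact: interior_subset.
Qed.

Lemma smooth_differentiable {R : realType} {V W : normedModType R}
    (f : V -> W) x :
  smooth_at f x -> differentiable f x.
Proof. by move=> [U [_ Ux /(_ 1%N)[]]] /(_ x Ux). Qed.

Lemma smooth_derive_continuous {R : realType} {V W : normedModType R}
    (f : V -> W) x v :
  smooth_at f x -> {for x, continuous ('D_v f)}.
Proof. by move=> [U [_ Ux /(_ 1%N)[_ /(_ v)]]] /(_ x Ux). Qed.

(** The difference quotients coincide. As a joint directional derivative, the left-hand side
    inherits continuity in [x] from joint smoothness. *)
Lemma derive_slice {R : realType} {U V W : normedModType R}
    (f : U * V -> W) u v x :
  'D_v (fun u => f (u, x)) u = 'D_(v, 0) f (u, x).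
Proof.
rewrite /derive; set F := (X in lim (X @ _)); set G := (X in _ = lim (X @ _)).
suff -> : F = G by [].
apply/funext => h; rewrite /F /G /=; congr (_ *: (f _ - _)).
by rewrite -[RHS]/(h *: v + u, h *: 0 + x) scaler0 add0r.
Qed.

Lemma differentiable_coord_comp {R : realType} {d} {V : normedModType R}
    (f : V -> 'rV[R]_d) x j :
  differentiable f x -> differentiable (fun x => f x 0 j) x.
Proof.
move=> df; apply: (@differentiable_comp _ _ _ _ f (fun y => y 0 j)) => //.
exact: differentiable_coord.
Qed.

(** * Kernels of the Jacobians of evaluation maps *)

Section Jacobian.
Context {R : realType} {n : nat -> nat} {m : nat}.
Implicit Types theta v : param R n m.

Lemma smooth_slice_differentiable theta x :
  parametrically_smooth theta x ->
  differentiable (fun u => realization u x) theta.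
Proof.
move=> /smooth_differentiable dF.
apply: (@differentiable_comp _ _ _ _ (fun u : param R n m => (u, x))
  (fun p => realization p.1 p.2)) => //.
Qed.

(** For row vectors, [v *m 'J] is the derivative along [v], and its entry at [mxvec_index i j] is
    coordinate [j] of the derivative at the point [z i]. *)
Lemma jacobian_eval_eq0 N (z : 'I_N -> 'rV[R]_(n 0%N)) theta v :
  (forall i, parametrically_smooth theta (z i)) ->
  v *m 'J (eval_map z) theta = 0 <->
  forall i, 'D_v (fun u => realization u (z i)) theta = 0.
Proof.
move=> sz; have dz i := smooth_slice_differentiable theta (z i) (sz i).
have evalE u i j :
    eval_map z u 0 (mxvec_index i j) = realization u (z i) 0 j.
  by rewrite /eval_map mxvecE mxE.
have dE : differentiable (eval_map z) theta.
  apply: differentiable_coordinates => k; case/mxvec_indexP: k => i j.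
  rewrite (_ : (fun _ => _) = (fun u => realization u (z i) 0 j)).
    exact: differentiable_coord_comp.
  by apply/funext => u; rewrite evalE.
have DE i j : (v *m 'J (eval_map z) theta) 0 (mxvec_index i j) =
    ('D_v (fun u => realization u (z i)) theta) 0 j.
  rewrite -deriveEjacobian// !derive_mx; [|exact: diff_derivable..].
  rewrite mxE [RHS]mxE (_ : (fun u => eval_map z u 0 (mxvec_index i j)) =
    (fun u => realization u (z i) 0 j))//.
  by apply/funext => u; rewrite evalE.
split=> [J0 i|D0].
  by apply/rowP => j; rewrite -DE J0 !mxE.
apply/rowP => k; case/mxvec_indexP: k => i j.
by rewrite DE D0 !mxE.
Qed.

Lemma near_eq_derive_masked s theta v x :
  in_pattern <%R s m theta x ->
  'D_v (fun u => realization u x) theta =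
  'D_v (fun u => masked_realization s m u x) theta.
Proof.
move=> h; apply: near_eq_derive.
apply: filterS (in_pattern_near_param _ _ _ _ h) => u /in_patternW hu.
exact: realization_masked.
Qed.

Lemma decisive_smooth theta Z z :
  transversal_param theta -> decisive theta Z -> Z z ->
  parametrically_smooth theta z.
Proof.
move=> trans [Zcells _] /Zcells [C [cC _] Cz].
have [s [_ /(_ z Cz) sz]] := cell_interior_pattern _ _ _ _ trans cC Cz.
exact: in_pattern_smooth sz.
Qed.

Lemma decisive_derive_eq0 theta v Z :
  transversal_param theta -> decisive theta Z ->
  (forall z, Z z -> 'D_v (fun u => realization u z) theta = 0) ->
  forall x, parametrically_smooth theta x ->
    'D_v (fun u => realization u x) theta = 0.
Proof.
move=> trans [_ Zsimplex] DZ.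
have Dregular y s : in_pattern <%R s m theta y ->
    'D_v (fun u => realization u y) theta = 0.
  (* The closed region of [s] is a cell with [y] in its interior, hence top-dimensional, and so
     contains a simplex of [Z]. *)
  move=> sy; pose C := [set x | in_pattern <=%R s m theta x].
  have Cy : C^° y.
    apply: filterS (in_pattern_near_point _ _ _ _ sy) => x.
    exact: in_patternW.
  have cC : canonical_complex theta C by exact: pattern_cell.
  have [p [pind ZC]] := Zsimplex C (conj cC (has_dim_interior _ _ Cy)).
  (* Strictness of [s] is known at [y]; that of [s'] holds on the whole interior, which contains [y]
     and the vertices. *)
  have [s' [_ Cs']] := cell_interior_pattern _ _ _ _ trans cC Cy.
  rewrite (near_eq_derive_masked s'); last exact: Cs'.
  apply: derive_masked_realization_eq0 pind _ => i.
  have [Zp Cp] : (Z `&` C^°) (p i) by rewrite ZC; exists i.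
  rewrite -(near_eq_derive_masked s'); last exact: Cs'.
  exact: DZ.
move=> x sx; pose D y := 'D_(v, 0) (fun p : param R n m * 'rV[R]_(n 0%N) =>
  realization p.1 p.2) (theta, y).
have DE y : 'D_v (fun u => realization u y) theta = D y.
  by rewrite /D -derive_slice.
have cD : {for x, continuous D}.
  have cs := polynomial_pair_continuous (cst theta) id
    (polynomial_map_cst theta) polynomial_id x.
  exact: (cvg_comp _ _ cs (smooth_derive_continuous _ _ (v, 0) sx)).
(* A nonzero derivative at [x] would stay nonzero on an open set, which meets the dense set of
   regular points. *)
rewrite DE; apply/eqP/negP => /negP Dx.
have : nbhs x [set y | D y != 0] by exact: (cvgr_neq0 _ cD Dx).
rewrite nbhsE => -[B [oB Bx] BD].
have [y [/BD Dy [s sy]]] :=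
  regular_points_dense _ _ trans B (ex_intro _ x Bx) oB.
by move: Dy; rewrite /= -DE (Dregular y s sy) eqxx.
Qed.

End Jacobian.

Theorem proposition5p16 (R : realType) (m : nat) (n : nat -> nat)
  (hm : (0 < m)%N) (hn : forall i, (i <= m)%N -> (0 < n i)%N)
  (theta : param R n m)
  (hgen : generic_param theta) (htrans : transversal_param theta)
  (hstab : comb_stable theta)
  (Z : set 'rV[R]_(n 0%N)) (hZ : decisive theta Z)
  (k : nat) (hk : (top_cells theta #= `I_k)%card)
  (z : 'I_(k * (n 0%N + 1))%N -> 'rV[R]_(n 0%N)) (hz : injective z) (hzZ : range z = Z)
  (V : set (param R n m)) (hVopen : open V) (hVtheta : V theta)
  (hVmem : preserves_membership V Z) (hVdec : forall v, V v -> decisive v Z) :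
  dim_fun theta = (\rank ('J (eval_map z) theta))%:R%:E.
Proof.
have zZ i : Z (z i) by rewrite -hzZ; exists i.
have sz i : parametrically_smooth theta (z i).
  exact: decisive_smooth htrans hZ (zZ i).
(* The family [z] is itself admissible in the supremum, which gives one inequality; the other
   compares left kernels. *)
apply/eqP; rewrite eq_le; apply/andP; split; last first.
  by apply: ereal_sup_ubound; exists (k * (n 0%N + 1))%N, z.
apply: ge_ereal_sup => _ [N [w [_ sw ->]]].
rewrite lee_fin ler_nat; apply: rank_le_kernel => v.
rewrite !jacobian_eval_eq0// => Dz i.
apply: (decisive_derive_eq0 _ _ _ htrans hZ _ _ (sw i)) => x.
by rewrite -hzZ => -[j _ <-].
Qed.
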